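(* The family $E_{3e}=E_{3e}(e_1,e_2,e_5,e_6)$ admits a shift operator for each of the shifts $e_1\to e_1\pm1$ and $e_j\to e_j\pm2$ ($j=5,6$), where in each case the other three of the free parameters $e_1,e_2,e_5,e_6$ are kept fixed.
   Context: Let $\partial=d/dx$ and $D=\mathbb{C}(x)[\partial]$. The operator $E_3(e)$: for $e=(e_1,\dots,e_7)$ with $e_1+\cdots+e_7=3$, put $$E_3(e)=x^2(x-1)^2\partial^3+x(x-1)(a_{21}x+a_{20})\partial^2+(a_{12}x^2+a_{11}x+a_{10})\partial+a_{01}x+A_{00}(e),$$ where $a_{21}=6-e_1-e_2-e_3-e_4$, $a_{20}=-3+e_1+e_2$, $a_{12}=(e_5+e_6+1)e_7+(e_6+1)(e_5+1)$, $a_{11}=-(e_5+e_6)e_7-e_1e_2+e_3e_4-e_5e_6+2e_1+2e_2-4$, $a_{10}=(e_1-1)(e_2-1)$, $a_{01}=e_5e_6e_7$, and $$\begin{aligned}54A_{00}(e)=&-4(e_1+e_2-e_3-e_4)^3-27e_5e_6e_7+9(e_1+e_2-e_3-e_4)(e_5e_6+e_5e_7+e_6e_7-2)\\&+9e_1e_2(e_1+e_2-1)+18(e_1+e_2-1)(e_3^2+e_3e_4+e_4^2)\\&-9e_3e_4(e_3+e_4-1)-18(e_3+e_4-1)(e_1^2+e_1e_2+e_2^2).\end{aligned}$$ $E_{3e}(e_1,e_2,e_5,e_6)$ is the specialization of $E_3(e)$ by $e_3=e_1-e_2$, $e_4=-e_2$ (and $e_7=3-(e_1+\cdots+e_6)$).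 Shift operators: let $E(p)$ be a family of third-order operators depending on parameters $p$, irreducible for generic $p$, and let $p\to p_+$ be a shift of the parameters by integers. A shift operator for this shift is a non-zero operator $P\in D$ of order lower than $3$, depending on $p$, sending the solution space of $E(p)$ to the solution space of $E(p_+)$; equivalently, there is $Q\in D$ with $E(p_+)\circ P=Q\circ E(p)$. The parameters are regarded as generic (indeterminates); the coefficients of $P$ are rational functions of $x$ and of $p$ (poles in $x$ are allowed; after normalization they may be taken polynomial in $p$ without common factor). *)

(* Defs.v *)
From HB Require Import structures.
From mathcomp Require Import all_boot all_order all_algebra.
From mathcomp Require Import generic_quotient reals complex mpoly ring.

Set Implicit Arguments.
Unset Strict Implicit.
Unset Printing Implicit Defensive.

Import GRing.Theory.
Local Open Scope ring_scope.
Local Open Scope quotient_scope.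

Local Lemma quot_add (K : fieldType) (a b c d a' b' c' d' : K) :
  b != 0 -> d != 0 ->
  ((a' * d + a * d' + (c' * b + c * b')) * (b * d)
   - (a * d + c * b) * (b' * d + b * d')) / (b * d) ^+ 2
  = (a' * b - a * b') / b ^+ 2 + (c' * d - c * d') / d ^+ 2.
Proof. by move=> b0 d0; field; rewrite b0 d0. Qed.

Local Lemma quot_mul (K : fieldType) (a b c d a' b' c' d' : K) :
  b != 0 -> d != 0 ->
  ((a' * c + a * c') * (b * d) - (a * c) * (b' * d + b * d')) / (b * d) ^+ 2
  = (a' * b - a * b') / b ^+ 2 * (c / d) + a / b * ((c' * d - c * d') / d ^+ 2).
Proof. by move=> b0 d0; field; rewrite b0 d0. Qed.

Notation ratfun F := {fraction {poly F}}.

Section DiffOp.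
Variable F : fieldType.
Implicit Types (f g : ratfun F) (p q : {poly F}).

Local Notation "p %:F" := (tofrac p).

(* d/dx on F(x), by the quotient rule applied to the chosen representative
   of the fraction; ratder_frac shows that the choice is immaterial *)
Definition ratder f : ratfun F :=
  let n := \n_(repr f) in let d := \d_(repr f) in
  (n^`() * d - n * d^`())%:F / d%:F ^+ 2.

Lemma fracE f : f = (\n_(repr f))%:F / (\d_(repr f))%:F.
Proof.
have d0 : (\d_(repr f))%:F != 0 by rewrite tofrac_eq0 denom_ratioP.
apply: (mulIf d0); rewrite mulfVK // -{1}[f]reprK; unlock tofrac.
rewrite -[LHS]FracField.pi_mul; apply/eqmodP; rewrite /= FracField.equivfE.
by rewrite /FracField.mulf !numden_Ratio ?(mulr1, mul1r, oner_neq0, denom_ratioP) // mulrC.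
Qed.

Lemma ratder_frac p q : q != 0 ->
  ratder (p%:F / q%:F) = (p^`() * q - p * q^`())%:F / q%:F ^+ 2.
Proof.
move=> q0; rewrite /ratder.
have := fracE (p%:F / q%:F); have := denom_ratioP (repr (p%:F / q%:F)).
move: (\n_(repr (p%:F / q%:F))) (\d_(repr (p%:F / q%:F))) => n d d0 /eqP.
have qF : q%:F != 0 by rewrite tofrac_eq0.
have dF : d%:F != 0 by rewrite tofrac_eq0.
rewrite (eqr_div _ _ qF dF) -2!tofracM tofrac_eq => /eqP pd.
apply/eqP; rewrite (eqr_div _ _ (expf_neq0 2 dF) (expf_neq0 2 qF)).
rewrite -2!tofracXn -2!tofracM tofrac_eq; apply/eqP.
have : (p * d)^`() = (n * q)^`() by rewrite pd.
rewrite !derivM => pd'.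
have h1 : (p^`() * q - p * q^`()) * d ^+ 2 =
  (p^`() * d + p * d^`()) * (d * q) - (p * d) * (d^`() * q + d * q^`()) by ring.
have h2 : (n^`() * d - n * d^`()) * q ^+ 2 =
  (n^`() * q + n * q^`()) * (d * q) - (n * q) * (d^`() * q + d * q^`()) by ring.
by rewrite h1 h2 pd' pd.
Qed.

Lemma ratder_poly p : ratder p%:F = (p^`())%:F.
Proof.
rewrite -[p%:F]divr1 -(tofrac1 {poly F}) ratder_frac ?oner_neq0 //.
by rewrite -polyC1 derivC mulr0 subr0 mulr1 polyC1 tofrac1 expr1n divr1.
Qed.

Lemma ratderD f g : ratder (f + g) = ratder f + ratder g.
Proof.
rewrite (fracE f) (fracE g).
have := denom_ratioP (repr f); have := denom_ratioP (repr g).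
move: (\n_(repr f)) (\d_(repr f)) (\n_(repr g)) (\d_(repr g)) => a b c d d0 b0.
have bF : b%:F != 0 by rewrite tofrac_eq0.
have dF : d%:F != 0 by rewrite tofrac_eq0.
rewrite (addf_div _ _ bF dF) -3!tofracM -tofracD.
rewrite (ratder_frac _ b0) (ratder_frac _ d0) (ratder_frac _ (mulf_neq0 b0 d0)).
rewrite !(derivD, derivM) !(tofracD, tofracN, tofracM) /=.
move: (a%:F) (b%:F) (c%:F) (d%:F) (a^`()%:F) (b^`()%:F) (c^`()%:F) (d^`()%:F) bF dF.
move=> A B C D A' B' C' D' B0 D0; exact (quot_add A C A' B' C' D' B0 D0).
Qed.

Lemma ratderM f g : ratder (f * g) = ratder f * g + f * ratder g.
Proof.
rewrite (fracE f) (fracE g).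
have := denom_ratioP (repr f); have := denom_ratioP (repr g).
move: (\n_(repr f)) (\d_(repr f)) (\n_(repr g)) (\d_(repr g)) => a b c d d0 b0.
have bF : b%:F != 0 by rewrite tofrac_eq0.
have dF : d%:F != 0 by rewrite tofrac_eq0.
rewrite mulf_div -2!tofracM.
rewrite (ratder_frac _ b0) (ratder_frac _ d0) (ratder_frac _ (mulf_neq0 b0 d0)).
rewrite !(derivD, derivM) !(tofracD, tofracN, tofracM) /=.
move: (a%:F) (b%:F) (c%:F) (d%:F) (a^`()%:F) (b^`()%:F) (c^`()%:F) (d^`()%:F) bF dF.
move=> A B C D A' B' C' D' B0 D0; exact (quot_mul A C A' B' C' D' B0 D0).
Qed.

(* The polynomial \sum_i a_i 'X^i over F(x) encodes the operator
   \sum_i a_i d^i, coefficients on the left. Addition and left scaling are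
   those of polynomials, and the order is (size P).-1, but composition is
   dcomp below, not the product of {poly _}. *)
Definition diffop := {poly ratfun F}.
Implicit Types P Q : diffop.

Definition dact P f : ratfun F := \sum_(i < size P) P`_i * iter i ratder f.

(* d o (\sum_j b_j d^j) = \sum_j b_j d^(j+1) + \sum_j b_j' d^j *)
Definition dcompX Q : diffop := 'X * Q + map_poly ratder Q.

Definition dcomp P Q : diffop := \sum_(i < size P) P`_i *: iter i dcompX Q.

Lemma ratder0 : ratder 0 = 0.
Proof. by rewrite -(tofrac0 {poly F}) ratder_poly raddf0 tofrac0. Qed.

Lemma dact_widen n P f : (size P <= n)%N ->
  dact P f = \sum_(i < n) P`_i * iter i ratder f.
Proof.
move=> le; rewrite /dact.
rewrite (big_ord_widen n (fun i => P`_i * iter i ratder f) le) big_mkcond /=.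
apply: eq_bigr => i _; case: ltnP => // /leq_sizeP/(_ i (leqnn _)) ->.
by rewrite mul0r.
Qed.

Lemma dactD P Q f : dact (P + Q) f = dact P f + dact Q f.
Proof.
rewrite (dact_widen f (size_polyD P Q)) (dact_widen f (leq_maxl (size P) (size Q))).
rewrite (dact_widen f (leq_maxr (size P) (size Q))) -big_split /=.
by apply: eq_bigr => i _; rewrite coefD mulrDl.
Qed.

Lemma dactZ c P f : dact (c *: P) f = c * dact P f.
Proof.
rewrite (dact_widen f (size_scale_leq c P)) /dact mulr_sumr.
by apply: eq_bigr => i _; rewrite coefZ mulrA.
Qed.

Lemma dact_dcompX Q f : dact (dcompX Q) f = ratder (dact Q f).
Proof.
have sX : (size ('X * Q)%R <= (size Q).+1)%N.
  by rewrite (leq_trans (size_polyMleq _ _)) // size_polyX.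
rewrite dactD (dact_widen f sX) (dact_widen f (size_poly _ _)) /dact.
rewrite big_ord_recl coefXM mul0r add0r -big_split /=.
rewrite (big_morph ratder ratderD ratder0).
apply: eq_bigr => i _; rewrite coefXM /= coef_map_id0 ?ratder0 //.
by rewrite ratderM addrC.
Qed.

Lemma dact_comp P Q f : dact (dcomp P Q) f = dact P (dact Q f).
Proof.
have D0 : dact 0 f = 0 by rewrite /dact size_poly0 big_ord0.
rewrite /dcomp (big_morph (dact^~ f) (fun P Q => dactD P Q f) D0).
apply: eq_bigr => i _; rewrite dactZ; congr (_ * _).
by elim: (nat_of_ord i) => //= n IH; rewrite dact_dcompX IH.
Qed.

(* The relation E' o P = Q o E says that P sends the solutions of E to
   solutions of E'. The bound is order P < 3. *)
Definition shift_operator (E E' P : diffop) : Prop :=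
  [/\ P != 0, (size P <= 3)%N & exists Q, dcomp E' P = dcomp Q E].

(* meant for e1 + ... + e7 = 3 in characteristic 0 *)
Definition E3 (e1 e2 e3 e4 e5 e6 e7 : F) : diffop :=
  let a21 := 6 - e1 - e2 - e3 - e4 in
  let a20 := -3 + e1 + e2 in
  let a12 := (e5 + e6 + 1) * e7 + (e6 + 1) * (e5 + 1) in
  let a11 := - (e5 + e6) * e7 - e1 * e2 + e3 * e4 - e5 * e6
             + 2 * e1 + 2 * e2 - 4 in
  let a10 := (e1 - 1) * (e2 - 1) in
  let a01 := e5 * e6 * e7 in
  let A00 :=
    (- 4 * (e1 + e2 - e3 - e4) ^+ 3 - 27 * e5 * e6 * e7
     + 9 * (e1 + e2 - e3 - e4) * (e5 * e6 + e5 * e7 + e6 * e7 - 2)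
     + 9 * e1 * e2 * (e1 + e2 - 1)
     + 18 * (e1 + e2 - 1) * (e3 ^+ 2 + e3 * e4 + e4 ^+ 2)
     - 9 * e3 * e4 * (e3 + e4 - 1)
     - 18 * (e3 + e4 - 1) * (e1 ^+ 2 + e1 * e2 + e2 ^+ 2)) / 54 in
  ('X ^+ 2 * ('X - 1) ^+ 2)%:F *: 'X^3
  + ('X * ('X - 1) * (a21 *: 'X + a20%:P))%:F *: 'X^2
  + (a12 *: 'X^2 + a11 *: 'X + a10%:P)%:F *: 'X
  + ((a01 *: 'X + A00%:P)%:F)%:P.

Definition E3e (e1 e2 e5 e6 : F) : diffop :=
  let e3 := e1 - e2 in
  let e4 := - e2 in
  E3 e1 e2 e3 e4 e5 e6 (3 - (e1 + e2 + e3 + e4 + e5 + e6)).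

End DiffOp.

(* C(e1, e2, e5, e6), with C = R[i]; the indeterminates 'X_0, ..., 'X_3 are
   e1, e2, e5, e6 in this order *)
Definition Cparam (R : realType) : fieldType := {fraction {mpoly R[i][4]}}.

Definition param (R : realType) (k : nat) : Cparam R :=
  tofrac ('X_(inord k) : {mpoly R[i][4]}).

(* A shift operator has coefficients in C(e1, e2, e5, e6)(x) and relates the
   generic member of the family to the one with parameters e_i + n_i *)
Definition admits_shift (R : realType)
    (E : Cparam R -> Cparam R -> Cparam R -> Cparam R -> diffop (Cparam R))
    (n1 n2 n5 n6 : int) : Prop :=
  let e1 := param R 0 in let e2 := param R 1 in
  let e5 := param R 2 in let e6 := param R 3 in
  exists P, shift_operator (E e1 e2 e5 e6)
    (E (e1 + n1%:~R) (e2 + n2%:~R) (e5 + n5%:~R) (e6 + n6%:~R)) P.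

(* Main.v *)
(* For each shift the intertwining relation E' P = Q E has explicit solutions
   P and Q. Comparing the local exponents of E and E' at 0, 1 and infinity
   forces the poles and the degrees of the coefficients of P, and the remaining
   scalars solve a linear system; Q is then obtained by passing to formal
   adjoints, since the adjoint of E3e(e1, e2, e5, e6) is
   - E3e(-e1, -e2, 2 - e5, 2 - e6). Only the shifts e1 -> e1 + 1, e1 -> e1 - 1
   and e5 -> e5 + 2 need a computation: E3 is symmetric in e5, e6, e7, and
   e5 -> e5 - 2 is e7 -> e7 + 2. *)
Require Import Defs.
From mathcomp Require Import all_boot all_order all_algebra.
From mathcomp Require Import reals.
From mathcomp Require Import complex mpoly ring.

Set Implicit Arguments.
Unset Strict Implicit.
Unset Printing Implicit Defensive.

Import GRing.Theory Num.Theory.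
Local Open Scope ring_scope.

Section Operators.
Variable F : fieldType.
Implicit Types (P Q : diffop F) (p q c d : {poly F}).

(** * Composition of operators with polynomial coefficients *)

Lemma coef_dcomp n P Q k : (size P <= n)%N ->
  (dcomp P Q)`_k = \sum_(i < n) P`_i * (iter i (@dcompX F) Q)`_k.
Proof.
move=> le; rewrite /dcomp coef_sum.
rewrite (big_ord_widen n (fun i => (P`_i *: iter i (@dcompX F) Q)`_k) le).
rewrite big_mkcond; apply: eq_bigr => i _; rewrite coefZ.
by case: ltnP => // /leq_sizeP/(_ i (leqnn _)) ->; rewrite mul0r.
Qed.

Lemma coef_dcompX Q k :
  (dcompX Q)`_k = (if k is j.+1 then Q`_j else 0) + ratder Q`_k.
Proof. by rewrite coefD coefXM coef_map_id0 ?ratder0 //; case: k. Qed.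

Definition pdiffop (s : seq {poly F}) : diffop F :=
  Poly (map (@tofrac {poly F}) s).

Lemma coef_pdiffop s k : (pdiffop s)`_k = tofrac s`_k.
Proof.
rewrite coef_Poly; have [lt|ge] := ltnP k (size s); first exact: nth_map.
by rewrite !nth_default ?size_map // tofrac0.
Qed.

Lemma size_pdiffop s : (size (pdiffop s) <= size s)%N.
Proof. by rewrite (leq_trans (size_Poly _)) ?size_map. Qed.

(** By Leibniz' rule the hypotheses compare the coefficients of d^5, ..., d^0, so an intertwining
    relation reduces to six identities in F[x]. *)
Lemma dcomp_pdiffop_eq d0 d1 d2 d3 p0 p1 p2 q0 q1 q2 c0 c1 c2 c3 :
  d3 * p2 = q2 * c3 ->
  d3 * (p1 + p2^`() *+ 3) + d2 * p2 = q2 * (c2 + c3^`() *+ 2) + q1 * c3 ->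
  d3 * (p0 + p1^`() *+ 3 + p2^`(2) *+ 3) + d2 * (p1 + p2^`() *+ 2) + d1 * p2
  = q2 * (c1 + c2^`() *+ 2 + c3^`(2)) + q1 * (c2 + c3^`()) + q0 * c3 ->
  d3 * (p0^`() *+ 3 + p1^`(2) *+ 3 + p2^`(3))
    + d2 * (p0 + p1^`() *+ 2 + p2^`(2)) + d1 * (p1 + p2^`()) + d0 * p2
  = q2 * (c0 + c1^`() *+ 2 + c2^`(2)) + q1 * (c1 + c2^`()) + q0 * c2 ->
  d3 * (p0^`(2) *+ 3 + p1^`(3)) + d2 * (p0^`() *+ 2 + p1^`(2))
    + d1 * (p0 + p1^`()) + d0 * p1
  = q2 * (c0^`() *+ 2 + c1^`(2)) + q1 * (c0 + c1^`()) + q0 * c1 ->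
  d3 * p0^`(3) + d2 * p0^`(2) + d1 * p0^`() + d0 * p0
  = q2 * c0^`(2) + q1 * c0^`() + q0 * c0 ->
  dcomp (pdiffop [:: d0; d1; d2; d3]) (pdiffop [:: p0; p1; p2])
  = dcomp (pdiffop [:: q0; q1; q2]) (pdiffop [:: c0; c1; c2; c3]).
Proof.
move=> E5 E4 E3 E2 E1 E0; apply/polyP => k.
rewrite (coef_dcomp _ _ (size_pdiffop _)) (coef_dcomp _ _ (size_pdiffop _)) /=.
rewrite !big_ord_recr !big_ord0 /=.
case: k => [|[|[|[|[|[|k]]]]]]; rewrite !coef_dcompX !coef_pdiffop /=.
all: rewrite ?tofrac0 -?tofracD ?ratder_poly ?ratderD ?ratder_poly.
have deriv0 : (0 : {poly F})^`() = 0 := raddf0 _.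
all: rewrite ?nth_nil ?(deriv0, tofrac0) ?addr0 ?add0r ?mulr0 //.
- by apply: etrans (etrans (congr1 (@tofrac _) E0) _) => /=; ring.
- by apply: etrans (etrans (congr1 (@tofrac _) E1) _) => /=; ring.
- by apply: etrans (etrans (congr1 (@tofrac _) E2) _) => /=; ring.
- by apply: etrans (etrans (congr1 (@tofrac _) E3) _) => /=; ring.
- by apply: etrans (etrans (congr1 (@tofrac _) E4) _) => /=; ring.
- by apply: etrans (etrans (congr1 (@tofrac _) E5) _) => /=; ring.
- by rewrite !addr0.
Qed.

(** * The family in coordinates and its three explicit relations *)

Definition quartic (k0 k1 k2 k3 k4 : F) : {poly F} :=
  k0%:P + k1%:P * 'X + k2%:P * 'X^2 + k3%:P * 'X^3 + k4%:P * 'X^4.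

(** Since this shape is closed under derivation, the six identities become derivative-free and fall
    to [ring]. *)
Lemma deriv_quartic k0 k1 k2 k3 k4 :
  (quartic k0 k1 k2 k3 k4)^`() = quartic k1 (2 * k2) (3 * k3) (4 * k4) 0.
Proof.
by rewrite /quartic !(derivD, deriv_mulC, derivC, derivX, derivXn) /=; ring.
Qed.

(* In terms of u = (e5 + e6 - 1) / 2 the operators below have integral
   coefficients. *)
Definition E3e_coefs (e1 e2 e5 u : F) : seq {poly F} :=
  let e6 := 2 * u + 1 - e5 in
  let e7 := 2 - 2 * e1 + e2 - 2 * u in
  [:: quartic ((e5 - e2) * u * (2 * u - 1 - e5 - e2 + 2 * e1)
               + e5 * (e5 - 1) * (1 - e1)) (e5 * e6 * e7) 0 0 0;
      quartic ((e1 - 1) * (e2 - 1))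
        (- (e5 + e6) * e7 - e1 * e2 - (e1 - e2) * e2 - e5 * e6
         + 2 * e1 + 2 * e2 - 4)
        ((e5 + e6 + 1) * e7 + (e6 + 1) * (e5 + 1)) 0 0;
      quartic 0 (3 - e1 - e2) (3 * e1 - 9) (6 - 2 * e1 + e2) 0;
      quartic 0 0 1 (-2) 1].

Lemma eq_tofracC_mul p q (r : diffop F) :
  p = q -> (tofrac p)%:P * r = (tofrac q)%:P * r :> {poly ratfun F}.
Proof. by move=> ->. Qed.

(** With u free up to this relation, the statement also covers e5 + 2 at fixed e6, where u becomes u
    + 1. *)
Lemma E3eE (e1 e2 e5 e6 u : F) : (54 : F) != 0 -> e6 = 2 * u + 1 - e5 ->
  E3e e1 e2 e5 e6 = pdiffop (E3e_coefs e1 e2 e5 u).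
Proof.
move=> ne54 ->; have polyE c0 c1 c2 c3 : pdiffop [:: c0; c1; c2; c3] =
    tofrac c3 *: 'X^3 + tofrac c2 *: 'X^2 + tofrac c1 *: 'X + (tofrac c0)%:P.
  apply/polyP => k; rewrite coef_pdiffop !(coefD, coefZ, coefXn) coefX coefC.
  by case: k => [|[|[|[|k]]]] /=;
    rewrite ?(mulr0, mulr1, add0r, addr0) ?nth_nil ?tofrac0.
rewrite /E3e /E3e_coefs polyE /E3 -!mul_polyC.
apply: congr2; last apply: (congr1 (fun z => (tofrac z)%:P)).
  apply: congr2; last apply: eq_tofracC_mul.
    by apply: congr2; apply: eq_tofracC_mul; rewrite /quartic; ring.
  by rewrite /quartic; ring.
rewrite /quartic !mul0r !addr0 addrC.
apply: congr2; first apply: (congr1 polyC).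
  (* This is the accessory parameter [A00], the only entry with a division by 54. *)
  by field.
by apply: (congr1 (fun z => z%:P * 'X)); ring.
Qed.

(** The top-degree part of P maps x^(-s) to (s - e5)(s - e6) x^(2-s), as e7 drops by 2 while e5 and
    e6 stay. Q is the adjoint of P taken at (-e1 - 1, -e2, 2 - e5, 2 - e6). *)
Lemma dcomp_e1_up (e1 e2 e5 u : F) : let e6 := 2 * u + 1 - e5 in
  dcomp (pdiffop (E3e_coefs (e1 + 1) e2 e5 u))
    (pdiffop
      [:: quartic (- e1 * (e1 - e2 + u)) (e2 * u - e5 * e6) (e5 * e6) 0 0;
          quartic 0 (u + 1 - e2) (e2 - 3 * u - 3) (2 * u + 2) 0;
          quartic 0 0 1 (-2) 1])
  = dcomp
    (pdiffop
      [:: quartic (- e1 * (e1 - e2 + u + 1))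
            (e2 * (u + 1) - (e5 * e6 + 2 * u + 2)) (e5 * e6 + 2 * u + 2) 0 0;
          quartic 0 (u + 2 - e2) (e2 - 3 * u - 6) (2 * u + 4) 0;
          quartic 0 0 1 (-2) 1])
    (pdiffop (E3e_coefs e1 e2 e5 u)).
Proof.
rewrite /=; apply: dcomp_pdiffop_eq;
  by rewrite ?derivSn ?derivn0 ?deriv_quartic /quartic; ring.
Qed.

(** Here e7 rises by 2: the top-degree part of P multiplies x^(-s) by (s - e7)(s + e7 - 1), so it
    kills x^(-e7). Q is the adjoint of P at (1 - e1, -e2, 2 - e5, 2 - e6), where e7 becomes -e7. *)
Lemma dcomp_e1_down (e1 e2 e5 u : F) : let e7 := 2 - 2 * e1 + e2 - 2 * u in
  dcomp (pdiffop (E3e_coefs (e1 - 1) e2 e5 u))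
    (pdiffop [:: quartic (e7 * (1 - e7)) 0 0 0 0; quartic (e2 - 1) 2 0 0 0;
                 quartic 0 (-1) 1 0 0])
  = dcomp
    (pdiffop [:: quartic (- e7 * (1 + e7)) 0 0 0 0; quartic (e2 - 1) 2 0 0 0;
                 quartic 0 (-1) 1 0 0])
    (pdiffop (E3e_coefs e1 e2 e5 u)).
Proof.
rewrite /=; apply: dcomp_pdiffop_eq;
  by rewrite ?derivSn ?derivn0 ?deriv_quartic /quartic; ring.
Qed.

(* l = e5 - e7 + 2 is the denominator of the solution P with leading
   coefficient x^2 (x - 1)^2; both sides are multiplied by it. *)
Lemma dcomp_e5_up (e1 e2 e5 u : F) :
  let e6 := 2 * u + 1 - e5 in
  let l := e5 + 2 * u + 2 * e1 - e2 in
  let n := (e5 - e2) * u * (u + e1 - e2) in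
  let k := (e5 + 2) * e6 + 2 * u + 4 in
  dcomp (pdiffop (E3e_coefs e1 e2 (e5 + 2) (u + 1)))
    (pdiffop
      [:: quartic n (l * (e2 * u - e5 * e6)) (l * (e5 * e6)) 0 0;
          quartic 0 (l * (u + 1 - e2)) (l * (e2 - 3 * u - 3))
            (l * (2 * u + 2)) 0;
          quartic 0 0 l (l * -2) l])
  = dcomp
    (pdiffop
      [:: quartic (n + l * (u + 1 - e2)) (l * (e2 * (u + 2) - k)) (l * k) 0 0;
          quartic 0 (l * (u + 3 - e2)) (l * (e2 - 3 * u - 9))
            (l * (2 * u + 6)) 0;
          quartic 0 0 l (l * -2) l])
    (pdiffop (E3e_coefs e1 e2 e5 u)).
Proof.
rewrite /=; apply: dcomp_pdiffop_eq;
  by rewrite ?derivSn ?derivn0 ?deriv_quartic /quartic; ring.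
Qed.

(** The scalar [k2] at x^2 d^2 witnesses P != 0; it is 1, 1 and [l] in the three relations. *)
Lemma shift_operator_pdiffop (E E' Q : diffop F) p0 p1 k0 k1 k2 k3 k4 :
  k2 != 0 ->
  let P := pdiffop [:: p0; p1; quartic k0 k1 k2 k3 k4] in
  dcomp E' P = dcomp Q E -> shift_operator E E' P.
Proof.
move=> k2n0 P EP; split; [|exact: size_pdiffop|by exists Q].
apply: contraNneq k2n0 => P0.
have /eqP : P`_2 = 0 by rewrite P0; apply: coef0.
rewrite coef_pdiffop tofrac_eq0 => /eqP.
move=> /(congr1 (fun p : {poly _} => p`_2)).
rewrite /quartic !(coefD, coefCM, coefXn, coefX, coefC) ?coef0 /=.
by rewrite !(mulr0, mulr1, add0r, addr0) => ->.
Qed.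

(** * Symmetries, and the shifts over a field where 54 is nonzero *)

Lemma E3_swap56 (e1 e2 e3 e4 e5 e6 e7 : F) :
  E3 e1 e2 e3 e4 e5 e6 e7 = E3 e1 e2 e3 e4 e6 e5 e7.
Proof.
rewrite /E3 -!mul_polyC.
apply: congr2; last by apply: (congr1 (fun z => (tofrac z)%:P)); ring.
by apply: congr2; [|apply: eq_tofracC_mul; ring].
Qed.

Lemma E3_swap57 (e1 e2 e3 e4 e5 e6 e7 : F) :
  E3 e1 e2 e3 e4 e5 e6 e7 = E3 e1 e2 e3 e4 e7 e6 e5.
Proof.
rewrite /E3 -!mul_polyC.
apply: congr2; last by apply: (congr1 (fun z => (tofrac z)%:P)); ring.
by apply: congr2; [|apply: eq_tofracC_mul; ring].
Qed.

Lemma E3e_swap56 (e1 e2 e5 e6 : F) : E3e e1 e2 e5 e6 = E3e e1 e2 e6 e5.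
Proof. by rewrite /E3e E3_swap56; congr (E3 _ _ _ _ _ _ _); ring. Qed.

Lemma E3e_swap57 (e1 e2 e5 e6 : F) :
  E3e e1 e2 e5 e6 = E3e e1 e2 (3 - 2 * e1 + e2 - e5 - e6) e6.
Proof. by rewrite /E3e E3_swap57; congr (E3 _ _ _ _ _ _ _); ring. Qed.

Lemma half_sum (e5 e6 : F) : (54 : F) != 0 ->
  e6 = 2 * ((e5 + e6 - 1) / 2) + 1 - e5.
Proof.
move=> char54; have ne2 : (2 : F) != 0.
  apply: contraNneq char54 => z; have -> : (54 : F) = 2 * 27 by ring.
  by rewrite z mul0r.
by field.
Qed.

Lemma shift_e1_up (e1 e2 e5 e6 : F) : (54 : F) != 0 ->
  exists P, shift_operator (E3e e1 e2 e5 e6) (E3e (e1 + 1%:~R) e2 e5 e6) P.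
Proof.
move=> char54; rewrite !(E3eE _ _ char54 (half_sum e5 e6 char54)).
eexists; apply: shift_operator_pdiffop (dcomp_e1_up _ _ _ _).
by rewrite oner_eq0.
Qed.

Lemma shift_e1_down (e1 e2 e5 e6 : F) : (54 : F) != 0 ->
  exists P, shift_operator (E3e e1 e2 e5 e6) (E3e (e1 + (-1)%:~R) e2 e5 e6) P.
Proof.
move=> char54; rewrite !(E3eE _ _ char54 (half_sum e5 e6 char54)).
eexists; apply: shift_operator_pdiffop (dcomp_e1_down _ _ _ _).
by rewrite oner_eq0.
Qed.

(** The nonzero quantity is e7 - e5 - 2 = -l, signed so that its constant term is a positive
    integer. *)
Lemma shift_e5_up (e1 e2 e5 e6 : F) : (54 : F) != 0 ->
  1%:R - 2 * e1 + e2 - 2 * e5 - e6 != 0 ->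
  exists P, shift_operator (E3e e1 e2 e5 e6) (E3e e1 e2 (e5 + 2%:~R) e6) P.
Proof.
move=> char54; set u := (e5 + e6 - 1) / 2.
have e6E : e6 = 2 * u + 1 - e5 := half_sum e5 e6 char54.
have e6E' : e6 = 2 * (u + 1) + 1 - (e5 + 2) by rewrite e6E; ring.
move=> l0; rewrite (E3eE _ _ char54 e6E) (E3eE _ _ char54 e6E').
eexists; apply: shift_operator_pdiffop (dcomp_e5_up _ _ _ _).
apply: contraNneq l0 => l0; apply/eqP.
by rewrite -oppr0 -l0 {1}e6E; ring.
Qed.

(** Exchanging e5 and e7 turns this into the upward shift; -l becomes e5 - e7 - 2, the negative of
    the quantity assumed nonzero. *)
Lemma shift_e5_down (e1 e2 e5 e6 : F) : (54 : F) != 0 ->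
  5 - 2 * e1 + e2 - 2 * e5 - e6 != 0 ->
  exists P, shift_operator (E3e e1 e2 e5 e6) (E3e e1 e2 (e5 + (-2)%:~R) e6) P.
Proof.
move=> char54; rewrite -[(-2)%:~R]/(- 2) => l0.
rewrite (E3e_swap57 e1 e2 e5) (E3e_swap57 e1 e2 (e5 - 2)).
set e7 := 3 - _ + _ - e5 - _.
have -> : 3 - 2 * e1 + e2 - (e5 - 2) - e6 = e7 + 2 by rewrite /e7; ring.
apply: shift_e5_up => //; apply: contraNneq l0 => l0; apply/eqP.
by rewrite -oppr0 -l0 /e7; ring.
Qed.

End Operators.

(** * Non-vanishing for indeterminate parameters *)

Section Genericity.
Variable R : realType.

(** Evaluation at the origin sends n + m to n, nonzero in characteristic 0. *)
Lemma natr_tofrac_neq0 (n : nat) (m : {mpoly R[i][4]}) :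
  (0 < n)%N -> meval (fun=> 0) m = 0 -> n%:R + tofrac m != 0 :> Cparam R.
Proof.
move=> n0 m0; rewrite -(rmorph_nat (@tofrac {mpoly R[i][4]})) -tofracD.
rewrite tofrac_eq0.
apply: contraTneq isT => /(congr1 (meval (fun=> 0))).
by rewrite mevalD m0 addr0 meval0 rmorph_nat => /eqP;
  rewrite pnatr_eq0 -[n]prednK.
Qed.

Lemma Cparam_char54 : (54 : Cparam R) != 0.
Proof. by rewrite -[54]addr0 -tofrac0 natr_tofrac_neq0 ?meval0. Qed.

Lemma param_linear_neq0 (n i j k l : nat) : (0 < n)%N ->
  n%:R - 2 * param R i + param R j - 2 * param R k - param R l != 0.
Proof.
move=> n0; pose m : {mpoly R[i][4]} :=
  - 2 * 'X_(inord i) + 'X_(inord j) - 2 * 'X_(inord k) - 'X_(inord l).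
rewrite (_ : _ - _ = n%:R + tofrac m); last by rewrite /m /param; ring.
apply: natr_tofrac_neq0 => //; rewrite /m.
by rewrite !(mevalD, mevalN, mevalM, mevalXU) !(mulr0, oppr0, addr0).
Qed.

End Genericity.

Theorem theorem6p1 (R : realType) :
  (admits_shift (@E3e (Cparam R)) 1 0 0 0 /\
   admits_shift (@E3e (Cparam R)) (-1) 0 0 0) /\
  (admits_shift (@E3e (Cparam R)) 0 0 2 0 /\
   admits_shift (@E3e (Cparam R)) 0 0 (-2) 0) /\
  (admits_shift (@E3e (Cparam R)) 0 0 0 2 /\
   admits_shift (@E3e (Cparam R)) 0 0 0 (-2)).
Proof.
have c54 := Cparam_char54 R.
rewrite /admits_shift !mulr0z !(addr0 (param R _)).
split.
  by split; [apply: (shift_e1_up _ _ _ _ c54)|apply: (shift_e1_down _ _ _ _ c54)].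
split; split.
- by apply: (shift_e5_up c54); apply: param_linear_neq0.
- by apply: (shift_e5_down c54); apply: param_linear_neq0.
(* Fixing the third argument keeps the repeated swap from undoing itself. *)
- rewrite !(E3e_swap56 _ _ (param R 2)).
  by apply: (shift_e5_up c54); apply: param_linear_neq0.
- rewrite !(E3e_swap56 _ _ (param R 2)).
  by apply: (shift_e5_down c54); apply: param_linear_neq0.
Qed.
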